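(* Let $f,g_1,\dots,g_m\in\mathbb{R}[x_1,\dots,x_n]$ and $K=\{\mathbf{x}\in\mathbb{R}^n : g_j(\mathbf{x})\ge 0,\ j=1,\dots,m\}$. Assume that $K$ is nonempty and compact, that $0\le g_j(\mathbf{x})\le 1$ for all $\mathbf{x}\in K$ and all $j$, and that the family $\{g_1,\dots,g_m,1-g_1,\dots,1-g_m\}$ generates the $\mathbb{R}$-algebra $\mathbb{R}[x_1,\dots,x_n]$. Let $f_K^\star=\inf_{\mathbf{x}\in K}f(\mathbf{x})$. Assume that Slater's condition holds, i.e. there is $\mathbf{x}_0\in\mathbb{R}^n$ with $g_j(\mathbf{x}_0)>0$ for all $j$. If $f$ and $-g_j$, $j=1,\dots,m$, are first-order SONC-convex polynomials of degree at most $2k$, then $$p_1^k=f_K^\star,$$ where $$p_1^k=\sup\Big\{t\in\mathbb{R} : L_1(\mathbf{x},\boldsymbol\lambda)-t\in(\Sigma+C)_{n,2k}\ \text{for some}\ \boldsymbol\lambda\ge 0\Big\}.$$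
   Context: Notation: $\mathbb{R}[\mathbf{x}]_{n,2k}$ is the space of real polynomials in $n$ variables of degree at most $2k$; $\mathbb{N}$ contains $0$. Lagrange polynomial at level $1$: let $\mathbb{N}^{2m}_1=\{(\mathbf{a},\mathbf{b})\in\mathbb{N}^m\times\mathbb{N}^m : |\mathbf{a}|+|\mathbf{b}|\le 1\}$, with $|\mathbf{a}|=\sum_j a_j$. For a vector $\boldsymbol\lambda=(\lambda_{\mathbf{a}\mathbf{b}})_{(\mathbf{a},\mathbf{b})\in\mathbb{N}^{2m}_1}$ of nonnegative reals, $$L_1(\mathbf{x},\boldsymbol\lambda)=f(\mathbf{x})-\sum_{(\mathbf{a},\mathbf{b})\in\mathbb{N}_1^{2m}}\lambda_{\mathbf{a}\mathbf{b}}\prod_{j=1}^m g_j(\mathbf{x})^{a_j}(1-g_j(\mathbf{x}))^{b_j}.$$ SOS cone: $\Sigma_{n,2k}$ is the set of finite sums of squares of polynomials of degree at most $k$ in $n$ variables. SONC cone: A circuit $(S,\boldsymbol\beta)$ consists of a finite affinely independent set $S\subseteq\mathbb{N}^n$ and a point $\boldsymbol\beta\in\mathbb{N}^n\setminus S$ in the relative interior of $\mathrm{conv}(S)$. A monomial square is a term $c\,\mathbf{x}^{\boldsymbol\alpha}$ with $c\ge0$ and $\boldsymbol\alpha\in 2\mathbb{N}^n$. A circuit polynomial is a polynomial that is either a sum of monomial squares or of the form $\sum_{\boldsymbol\alpha\in S}c_{\boldsymbol\alpha}\mathbf{x}^{\boldsymbol\alpha}+\delta\,\mathbf{x}^{\boldsymbol\beta}$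 with $(S,\boldsymbol\beta)$ a circuit, $S\subseteq 2\mathbb{N}^n$, all $c_{\boldsymbol\alpha}>0$ and $\delta\in\mathbb{R}$. A polynomial is SONC if it is a finite conic combination of circuit polynomials that are nonnegative on $\mathbb{R}^n$. $C_{n,2k}$ is the cone of all SONC polynomials in $\mathbb{R}[\mathbf{x}]_{n,2k}$. SOS+SONC cone: $(\Sigma+C)_{n,2k}=\Sigma_{n,2k}+C_{n,2k}$. First-order SONC-convexity: $h\in\mathbb{R}[\mathbf{x}]_{n,2k}$ is first-order SONC-convex if $g_h(\mathbf{x},\mathbf{y})=h(\mathbf{x})-h(\mathbf{y})-\nabla h(\mathbf{y})^\top(\mathbf{x}-\mathbf{y})$, regarded as a polynomial in the $2n$ variables $(\mathbf{x},\mathbf{y})$, belongs to $C_{2n,2k}$. *)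

(* Defs.v *)
From HB Require Import structures.
From mathcomp Require Import all_boot all_order all_algebra finmap.
(* [mpoly] has to be imported before the analysis files: in the other order its
   notations at level 2 are rejected. *)
From mathcomp Require Import mpoly.
From mathcomp Require Import mathcomp_extra boolp classical_sets functions.
From mathcomp Require Import reals ereal topology normedtype.

Set Implicit Arguments.
Unset Strict Implicit.
Unset Printing Implicit Defensive.

Import Order.TTheory GRing.Theory Num.Theory.
Import numFieldNormedType.Exports.

Local Open Scope classical_set_scope.
Local Open Scope ring_scope.

Section ConvexGeometry.
Variables (R : realType) (n : nat).
Implicit Types (A : set 'rV[R]_n) (x : 'rV[R]_n).

Definition convex_hull A : set 'rV[R]_n :=
  [set x | exists N (p : 'I_N -> 'rV[R]_n) (c : 'I_N -> R),
    [/\ forall i, A (p i), forall i, 0 <= c i, \sum_i c i = 1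
      & x = \sum_i c i *: p i]].

Definition affine_hull A : set 'rV[R]_n :=
  [set x | exists N (p : 'I_N -> 'rV[R]_n) (c : 'I_N -> R),
    [/\ forall i, A (p i), \sum_i c i = 1 & x = \sum_i c i *: p i]].

Definition relative_interior A : set 'rV[R]_n :=
  [set x | A x /\ \forall y \near x, affine_hull A y -> A y].

End ConvexGeometry.

Section Sonc.
Variable R : realType.

Definition exponent_point n (a : 'X_{1..n}) : 'rV[R]_n := \row_i (a i)%:R.

Definition even_exponent n (a : 'X_{1..n}) := [forall i, ~~ odd (a i)].

Definition affinely_independent n (S : {fset 'X_{1..n}}) : Prop :=
  forall c : 'X_{1..n} -> R,
    \sum_(a <- S) c a = 0 -> \sum_(a <- S) c a *: exponent_point a = 0 ->
    forall a, a \in S -> c a = 0.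

Definition circuit n (S : {fset 'X_{1..n}}) (b : 'X_{1..n}) : Prop :=
  [/\ affinely_independent S, b \notin S
    & relative_interior (convex_hull [set exponent_point a | a in [set` S]])
        (exponent_point b)].

Definition monomial_square n (p : {mpoly R[n]}) : Prop :=
  exists (c : R) (a : 'X_{1..n}),
    [/\ 0 <= c, even_exponent a & p = c *: 'X_[a]].

Definition circuit_polynomial n (p : {mpoly R[n]}) : Prop :=
  (exists N (q : 'I_N -> {mpoly R[n]}),
     (forall i, monomial_square (q i)) /\ p = \sum_i q i) \/
  (exists (S : {fset 'X_{1..n}}) (b : 'X_{1..n}) (c : 'X_{1..n} -> R) (d : R),
     [/\ circuit S b, forall a, a \in S -> even_exponent a,
         forall a, a \in S -> 0 < c a
       & p = \sum_(a <- S) c a *: 'X_[a] + d *: 'X_[b]]).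

Definition nonneg_poly n (p : {mpoly R[n]}) : Prop :=
  forall x : 'I_n -> R, 0 <= p.@[x].

Definition sonc n (p : {mpoly R[n]}) : Prop :=
  exists N (w : 'I_N -> R) (q : 'I_N -> {mpoly R[n]}),
    [/\ forall i, 0 <= w i, forall i, circuit_polynomial (q i),
        forall i, nonneg_poly (q i) & p = \sum_i w i *: q i].

(* [msize p] is one more than the total degree of [p] (and [msize 0 = 0]). *)
Definition degree_le n (d : nat) : set {mpoly R[n]} :=
  [set p | (msize p <= d.+1)%N].

Definition sos_cone n k : set {mpoly R[n]} :=
  [set p | exists N (q : 'I_N -> {mpoly R[n]}),
    (forall i, degree_le k (q i)) /\ p = \sum_i q i ^+ 2].

Definition sonc_cone n k : set {mpoly R[n]} :=
  [set p | degree_le (2 * k) p /\ sonc p].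

Definition sos_sonc_cone n k : set {mpoly R[n]} :=
  [set p + q | p in @sos_cone n k & q in @sonc_cone n k].

(* [h(x) - h(y) - grad h(y)^T (x - y)], where the first [n] of the [n + n]
   variables are [x] and the last [n] are [y]. *)
Definition first_order_gap n (h : {mpoly R[n]}) : {mpoly R[n + n]} :=
  let x := [tuple 'X_(lshift n i) : {mpoly R[n + n]} | i < n] in
  let y := [tuple 'X_(rshift n i) : {mpoly R[n + n]} | i < n] in
  (h \mPo x) - (h \mPo y)
    - \sum_(i < n) (h^`M(i) \mPo y) * (tnth x i - tnth y i).

Definition first_order_sonc_convex n k (h : {mpoly R[n]}) : Prop :=
  degree_le (2 * k) h /\ sonc_cone k (first_order_gap h).

End Sonc.

Section Lagrange.
Variable R : realType.

Definition feasible_set n m (g : 'I_m -> {mpoly R[n]}) : set 'rV[R]_n :=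
  [set x : 'rV[R]_n | forall j, 0 <= (g j).@[x ord0]].

Definition generates_algebra n (G : set {mpoly R[n]}) : Prop :=
  forall A : {pred {mpoly R[n]}},
    GRing.subalg_closed A -> (forall q, G q -> q \in A) -> forall p, p \in A.

Definition lagrange_index m d :=
  {ab : 'X_{1..m < d.+1} * 'X_{1..m < d.+1} | (mdeg ab.1 + mdeg ab.2 <= d)%N}.
HB.instance Definition _ m d := Finite.on (lagrange_index m d).

Definition lagrange_polynomial n m d (f : {mpoly R[n]})
    (g : 'I_m -> {mpoly R[n]}) (lambda : lagrange_index m d -> R) :
    {mpoly R[n]} :=
  f - \sum_(ab : lagrange_index m d)
        lambda ab *: \prod_(j < m)
          (g j ^+ (val ab).1 j * (1 - g j) ^+ (val ab).2 j).

(* The supremum is taken in the extended reals ([-oo] if no [t] qualifies). *)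
Definition lagrange_bound n m d k (f : {mpoly R[n]})
    (g : 'I_m -> {mpoly R[n]}) : \bar R :=
  ereal_sup [set t%:E | t in [set t : R |
    exists lambda : lagrange_index m d -> R, (forall ab, 0 <= lambda ab) /\
      sos_sonc_cone k (lagrange_polynomial f g lambda - t%:MP)]].

End Lagrange.

(* Main.v *)
Require Import Defs.
From HB Require Import structures.
From mathcomp Require Import all_boot all_order all_algebra finmap.
From mathcomp Require Import mpoly.
From mathcomp Require Import mathcomp_extra boolp classical_sets functions.
From mathcomp Require Import reals ereal topology normedtype.
From mathcomp Require Import ring lra.
From mathcomp Require Import sequences derive realfun exp.

Set Implicit Arguments.
Unset Strict Implicit.
Unset Printing Implicit Defensive.

Import Order.TTheory GRing.Theory Num.Theory.
Import numFieldNormedType.Exports.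

Local Open Scope classical_set_scope.
Local Open Scope ring_scope.

(** The infimum over [K] bounds the supremum from above by weak duality: an
    element of the SOS+SONC cone is nonnegative everywhere, and on [K] the
    products of the [g j] and [1 - g j] are nonnegative.

    The reverse bound exhibits a feasible [t], namely the minimum of [f] over
    [K] itself, attained at some [x]. First-order SONC-convexity implies
    ordinary convexity, so Slater's condition and Farkas' lemma give KKT
    multipliers [lam] at [x] (lemma [kkt]). Writing [gap h] for the polynomial
    [h(x') - h(y) - grad h(y)^T (x' - y)], stationarity and complementary
    slackness turn the Lagrangian into a sum of gaps frozen at [y = x]:
    [f - \sum_j lam j *: g j - f(x) =
       gap f (-, x) + \sum_j lam j *: gap (- g j) (-, x)].
    Each gap is SONC in the [2n] variables [(x', y)]; what is left to prove is
    that a SONC polynomial stays SONC when some of its variables are given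
    fixed values ([sonc_fix_right]).

    Fixing variables destroys circuits: projected exponents may coincide,
    become affinely dependent, or absorb the inner exponent. The remedy is to
    work with the inequality behind circuits instead. Weighted AM-GM shows that
    [\sum_i lam_i e^(u_i) X^(a_i) + d X^b] is nonnegative as soon as the [a_i]
    are even, [b] is the barycentre of the [a_i] with weights [lam], and
    [|d| <= e^(\sum_i lam_i u_i)] ([amgm_nonneg]). Three facts then suffice.
    - A nonnegative circuit polynomial either is a sum of monomial squares, or
      has this form up to monomial squares ([circuit_bound]); this is the
      circuit number criterion.
    - The form is preserved by fixing variables: the values of the frozen
      monomials are absorbed into the [u_i] ([fix_right_amgm]).
    - Every polynomial of this form is SONC ([sonc_amgm]). If the exponents of
      nonzero weight are affinely dependent, the weights split as a convex
      combination of two weight vectors of smaller support, and by convexity of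
      the exponential [d] can be split accordingly; by induction one reaches
      affinely independent exponents, which form a circuit with [b] unless [b]
      is one of them. *)

(** * Farkas' lemma and the KKT conditions *)

Section Farkas.
Variable R : realFieldType.

Definition dot n (a x : 'rV[R]_n) : R := \sum_k a ord0 k * x ord0 k.

Lemma dotDl n (a b x : 'rV[R]_n) : dot (a + b) x = dot a x + dot b x.
Proof. by rewrite -big_split; apply: eq_bigr => k _; rewrite mxE mulrDl. Qed.

Lemma dotDr n (a x y : 'rV[R]_n) : dot a (x + y) = dot a x + dot a y.
Proof. by rewrite -big_split; apply: eq_bigr => k _; rewrite mxE mulrDr. Qed.

Lemma dotZl n c (a x : 'rV[R]_n) : dot (c *: a) x = c * dot a x.
Proof. by rewrite mulr_sumr; apply: eq_bigr => k _; rewrite mxE mulrA. Qed.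

Lemma dotZr n c (a x : 'rV[R]_n) : dot a (c *: x) = c * dot a x.
Proof. by rewrite mulr_sumr; apply: eq_bigr => k _; rewrite mxE mulrCA. Qed.

Lemma dotNl n (a x : 'rV[R]_n) : dot (- a) x = - dot a x.
Proof. by rewrite -scaleN1r dotZl mulN1r. Qed.

Lemma dotNr n (a x : 'rV[R]_n) : dot a (- x) = - dot a x.
Proof. by rewrite -scaleN1r dotZr mulN1r. Qed.

Lemma dot0l n (x : 'rV[R]_n) : dot 0 x = 0.
Proof. by rewrite -(scale0r (0 : 'rV_n)) dotZl mul0r. Qed.

Lemma dot_suml n I (r : seq I) (P : pred I) (F : I -> 'rV[R]_n) x :
  dot (\sum_(i <- r | P i) F i) x = \sum_(i <- r | P i) dot (F i) x.
Proof. by elim/big_rec2: _ => [|i c a _ <-]; rewrite ?dot0l ?dotDl. Qed.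

(** Induction on the number of constraints. If the first constraint cannot be
    dropped, some [x] satisfies the others but has [dot b x < 0], hence
    [dot (a ord0) x < 0]; subtracting from all forms the multiple of [a ord0]
    that makes them vanish at [x] removes this constraint. *)
Lemma farkas n m (a : 'I_m -> 'rV[R]_n) (b : 'rV[R]_n) :
  (forall x, (forall j, 0 <= dot (a j) x) -> 0 <= dot b x) ->
  exists2 lam : 'I_m -> R,
    forall j, 0 <= lam j & b = \sum_j lam j *: a j.
Proof.
elim: m a b => [|m IH] a b ab.
  exists (fun=> 0) => //; rewrite big_ord0.
  have: 0 <= dot b (- b) by apply: ab => -[].
  rewrite dotNr oppr_ge0 => b_le0.
  apply/rowP => k; rewrite mxE.
  have b2_ge0 i : true -> 0 <= b ord0 i * b ord0 i by rewrite -expr2 sqr_ge0.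
  have /eqP := le_anti (introT andP (conj b_le0 (sumr_ge0 _ b2_ge0))).
  rewrite psumr_eq0// => /allP/(_ k (mem_index_enum _)).
  by rewrite mulf_eq0 orbb => /eqP.
have [h|] := pselect (forall x, (forall j, 0 <= dot (a (lift ord0 j)) x) ->
    0 <= dot b x).
  have [lam lam0 ->] := IH _ _ h.
  exists (fun i => if unlift ord0 i is Some j then lam j else 0).
    by move=> i; case: unliftP.
  rewrite big_ord_recl unlift_none scale0r add0r.
  by apply: eq_bigr => j _; rewrite liftK.
move=> /existsNP[x /not_implyP[ax /negP]]; rewrite -ltNge => bx.
have a0x : dot (a ord0) x < 0.
  rewrite ltNge; apply/negP => a0x; move: bx; rewrite ltNge => /negP; apply.
  by apply: ab => j; case: (unliftP ord0 j) => [i ->|->].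
pose c := - (dot (a ord0) x)^-1.
have c_gt0 : 0 < c by rewrite oppr_gt0 invr_lt0.
have ca0x : c * dot (a ord0) x = -1.
  by rewrite mulNr mulVf// lt_eqF.
pose proj (u : 'rV[R]_n) := u + (c * dot u x) *: a ord0.
have dot_proj u y : dot (proj u) y = dot u (y + (c * dot (a ord0) y) *: x).
  by rewrite dotDl dotZl dotDr dotZr; congr (_ + _); ring.
have [|lam lam0 blam] := IH (fun j => proj (a (lift ord0 j))) (proj b).
  move=> y ay; rewrite dot_proj; apply: ab => j.
  case: (unliftP ord0 j) => [i ->|->]; first by rewrite -dot_proj.
  by rewrite dotDr dotZr mulrAC ca0x mulN1r subrr.
exists (fun i => if unlift ord0 i is Some j then lam j else
    \sum_j lam j * (c * dot (a (lift ord0 j)) x) - c * dot b x).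
  move=> i; case: unliftP => // _.
  rewrite subr_ge0 (@le_trans _ _ 0)//.
    by rewrite mulr_ge0_le0// ltW.
  by apply: sumr_ge0 => j _; rewrite !mulr_ge0// ltW.
rewrite big_ord_recl unlift_none scalerBl.
rewrite -[LHS](addrK ((c * dot b x) *: a ord0)) -/(proj b) blam addrAC.
congr (_ - _); rewrite scaler_suml -big_split; apply: eq_bigr => j _ /=.
by rewrite liftK /proj scalerDr scalerA addrC.
Qed.

End Farkas.

Section KKT.
Variables (R : realType) (n : nat).

Lemma continuous_meval (T : topologicalType) (p : {mpoly R[n]})
    (u : T -> 'I_n -> R) :
  (forall i, continuous (u ^~ i)) -> continuous (fun t => p.@[u t]).
Proof.
move=> cu.
have -> : (fun t => p.@[u t]) =
    (fun t => \sum_(a <- msupp p) p@_a * \prod_i u t i ^+ a i).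
  by apply/funext => t; rewrite mevalE.
apply: (@continuous_big R _ +%R 0 xpredT) => [|a _].
  exact: add_continuous.
move=> t; apply: cvgM; first exact: cvg_cst.
move: t; apply: (@continuous_big R _ *%R 1 xpredT) => [|i _].
  exact: mul_continuous.
move=> t; apply: (@continuous_comp _ _ _ (u^~ i) (fun y => y ^+ a i)).
  exact: cu.
exact: exprn_continuous.
Qed.

Lemma continuous_dot (T : topologicalType) (u : T -> 'rV[R]_n) v :
  (forall i, continuous (fun t => u t ord0 i)) ->
  continuous (fun t => dot (u t) v).
Proof.
move=> cu; apply: (@continuous_big R _ +%R 0 xpredT) => [|i _].
  exact: add_continuous.
by move=> t; apply: cvgM; [exact: cu | exact: cvg_cst].
Qed.

Definition gradient (p : {mpoly R[n]}) (x : 'rV[R]_n) : 'rV[R]_n :=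
  \row_i (p^`M(i)).@[x ord0].

Definition convex_poly (p : {mpoly R[n]}) : Prop :=
  forall x y : 'rV[R]_n,
    p.@[y ord0] + dot (gradient p y) (x - y) <= p.@[x ord0].

Lemma gradientN p x : gradient (- p) x = - gradient p x.
Proof. by apply/rowP => i; rewrite !mxE mderivN mevalN. Qed.

(** Farkas' lemma applies to the gradients of the constraints active at [x]
    once every direction [d] that is weakly feasible for them satisfies
    [0 <= dot (gradient f x) d]. Otherwise, perturbing [d] towards the Slater
    point makes it strictly feasible while still a descent direction. Convexity
    is used with the gradient taken at the moved point, so that continuity of
    the gradients replaces Taylor expansions: for small [t > 0] the point
    [x + t *: e] is feasible and has a smaller value of [f]. *)
Lemma kkt m (f : {mpoly R[n]}) (g : 'I_m -> {mpoly R[n]}) (x x0 : 'rV[R]_n) :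
  convex_poly f -> (forall j, convex_poly (- g j)) ->
  (forall j, 0 < (g j).@[x0 ord0]) -> feasible_set g x ->
  (forall y, feasible_set g y -> f.@[x ord0] <= f.@[y ord0]) ->
  exists lam : 'I_m -> R,
    [/\ forall j, 0 <= lam j,
        gradient f x = \sum_j lam j *: gradient (g j) x
      & forall j, lam j * (g j).@[x ord0] = 0].
Proof.
move=> f_cvx g_cvx x0_slater x_feas x_min.
have g_ccv j (y z : 'rV[R]_n) :
    (g j).@[z ord0] <= (g j).@[y ord0] + dot (gradient (g j) y) (z - y).
  have := g_cvx j z y.
  by rewrite gradientN dotNl !mevalN; lra.
pose active j := (g j).@[x ord0] == 0.
have [d gd|lam lam0 flam] := @farkas _ _ _
  (fun j => if active j then gradient (g j) x else 0) (gradient f x);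
  last first.
  exists (fun j => if active j then lam j else 0); split.
  - by move=> j; case: ifP.
  - rewrite flam; apply: eq_bigr => j _.
    by case: ifP => _; rewrite ?scale0r ?scaler0.
  - by move=> j; case: ifP => [/eqP ->|_]; rewrite ?mulr0 ?mul0r.
rewrite leNgt; apply/negP => fd.
(* [eps] is small enough to keep the perturbed direction [e] descending. *)
pose c := dot (gradient f x) (x0 - x).
have c1 : 0 < `|c| + 1 by rewrite ltr_wpDl.
pose eps := - dot (gradient f x) d / (`|c| + 1).
have eps_gt0 : 0 < eps by rewrite divr_gt0// oppr_gt0.
pose e := d + eps *: (x0 - x).
have fe : dot (gradient f x) e < 0.
  rewrite dotDr dotZr -/c.
  have -> : dot (gradient f x) d = - (eps * (`|c| + 1)).
    by rewrite /eps divfK ?opprK// gt_eqF.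
  have := ler_norm c; nra.
have ge j : active j -> 0 < dot (gradient (g j) x) e.
  move=> act_j; have := gd j; rewrite act_j dotDr dotZr => gdj.
  rewrite ltr_wpDl// mulr_gt0//.
  by have := g_ccv j x x0; rewrite (eqP act_j) add0r; exact: lt_le_trans.
pose path (t : R) : 'rV[R]_n := x + t *: e.
have path0 : path 0 = x by rewrite /path scale0r addr0.
have cpath i : continuous (fun t => path t ord0 i).
  have -> : (fun t => path t ord0 i) = (fun t => x ord0 i + t * e ord0 i).
    by apply/funext => t; rewrite !mxE.
  move=> t; apply: cvgD; first exact: cvg_cst.
  by apply: cvgM; [exact: cvg_id | exact: cvg_cst].
have cpoly (p : {mpoly R[n]}) : continuous (fun t => p.@[path t ord0]).
  by apply: continuous_meval => i; exact: cpath.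
have cgrad (p : {mpoly R[n]}) :
    continuous (fun t => dot (gradient p (path t)) e).
  apply: continuous_dot => i.
  have -> : (fun t => gradient p (path t) ord0 i) =
      (fun t => (p^`M(i)).@[path t ord0]) by apply/funext => s; rewrite mxE.
  exact: cpoly.
have nbhs_right (A : set R) : (\forall t \near 0, A t) ->
    \forall t \near 0^'+, A t by exact: cvg_within.
have grad_near (p : {mpoly R[n]}) (s : R) : 0 < s * dot (gradient p x) e ->
    \forall t \near 0^'+, 0 < s * dot (gradient p (path t)) e.
  move=> pe; apply: nbhs_right.
  have : s * dot (gradient p (path t)) e @[t --> (0 : R)] -->
      s * dot (gradient p (path 0)) e.
    by apply: cvgM; [exact: cvg_cst | exact: cgrad].
  by move/cvgr_gt; apply; rewrite path0.
have feas : \forall t \near 0^'+, forall j, 0 <= (g j).@[path t ord0].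
  apply: filter_forall => j; have [act_j|inact_j] := boolP (active j).
    near=> t.
    have t_gt0 : 0 < t by near: t; exact: nbhs_right_gt.
    have : 0 < 1 * dot (gradient (g j) (path t)) e.
      by near: t; apply: grad_near; rewrite mul1r ge.
    have := g_ccv j (path t) x.
    rewrite (eqP act_j) /path opprD addNKr dotNr dotZr mul1r.
    nra.
  have gx : 0 < (g j).@[x ord0] by rewrite lt_neqAle eq_sym inact_j x_feas.
  apply: nbhs_right.
  have : (g j).@[path t ord0] @[t --> (0 : R)] --> (g j).@[path 0 ord0].
    exact: cpoly.
  by rewrite path0 => /cvgr_gt /(_ _ gx); apply: filterS => t /ltW.
have [t [t_gt0 t_feas t_f]] : exists t : R, [/\ 0 < t,
    feasible_set g (path t) & dot (gradient f (path t)) e < 0].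
  apply: (@filter_ex _ (0 : R)^'+).
  near=> t; split.
  - by near: t; exact: nbhs_right_gt.
  - by near: t; exact: feas.
  - rewrite -oppr_gt0 -mulN1r; near: t; apply: grad_near.
    by rewrite mulN1r oppr_gt0.
have := f_cvx x (path t); have := x_min _ t_feas.
rewrite {2}/path opprD addNKr dotNr dotZr.
nra.
Unshelve. all: by end_near. Qed.

End KKT.

(** * The SONC cone *)

Section SoncCone.
Variables (R : realType) (n : nat).
Implicit Types p q : {mpoly R[n]}.

Lemma sonc0 : sonc (0 : {mpoly R[n]}).
Proof.
exists 0%N, (fun=> 0), (fun=> 0); split; try by case.
by rewrite big_ord0.
Qed.

Lemma soncD p q : sonc p -> sonc q -> sonc (p + q).
Proof.
move=> [N [w [s [w0 sc sn ->]]]] [M [v [t [v0 tc tn ->]]]].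
exists (N + M)%N,
  (fun i => match fintype.split i with inl j => w j | inr j => v j end),
  (fun i => match fintype.split i with inl j => s j | inr j => t j end).
split=> [i|i|i|]; try by case: fintype.splitP.
rewrite big_split_ord; congr (_ + _); apply: eq_bigr => i _.
  by rewrite (unsplitK (inl i)).
by rewrite (unsplitK (inr i)).
Qed.

Lemma soncZ c p : 0 <= c -> sonc p -> sonc (c *: p).
Proof.
move=> c0 [N [w [s [w0 sc sn ->]]]].
exists N, (fun i => c * w i), s; split=> //.
  by move=> i; rewrite mulr_ge0.
by rewrite scaler_sumr; apply: eq_bigr => i _; rewrite scalerA.
Qed.

Lemma sonc_sum (I : Type) (r : seq I) (P : pred I) (F : I -> {mpoly R[n]}) :
  (forall i, P i -> sonc (F i)) -> sonc (\sum_(i <- r | P i) F i).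
Proof. by move=> FP; elim/big_ind: _ => //; [exact: sonc0|exact: soncD]. Qed.

Lemma sonc_circuit p : circuit_polynomial p -> nonneg_poly p -> sonc p.
Proof.
move=> pc pn; exists 1%N, (fun=> 1), (fun=> p); split=> //.
by rewrite big_ord1 scale1r.
Qed.

Lemma sonc_nonneg p : sonc p -> nonneg_poly p.
Proof.
move=> [N [w [s [w0 _ sn ->]]]] x; rewrite raddf_sum sumr_ge0//= => i _.
by rewrite mevalZ mulr_ge0// sn.
Qed.

Lemma even_monomial_ge0 (x : 'I_n -> R) (a : 'X_{1..n}) :
  even_exponent a -> 0 <= \prod_i x i ^+ a i.
Proof.
by move=> /forallP ev; apply: prodr_ge0 => i _; rewrite exprn_even_ge0.
Qed.

Lemma sonc_monomial_square c (a : 'X_{1..n}) :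
  0 <= c -> even_exponent a -> sonc (c *: 'X_[a] : {mpoly R[n]}).
Proof.
move=> c0 ev; apply: sonc_circuit.
  left; exists 1%N, (fun=> c *: 'X_[a]); rewrite big_ord1; split=> // _.
  by exists c, a.
by move=> x; rewrite mevalZ mevalX mulr_ge0// even_monomial_ge0.
Qed.

End SoncCone.

(** * Weighted arithmetic-geometric mean polynomials *)

Section WeightedAMGM.
Variables (R : realType) (n : nat).
Implicit Types (I : finType) (b : 'X_{1..n}).

Definition log_monomial (x : 'I_n -> R) b : R := \sum_k (b k)%:R * ln `|x k|.

(** Coordinates outside the support of [b] may vanish: the meaningless [ln 0]
    has coefficient 0 there. *)
Lemma normr_monomial (x : 'I_n -> R) b :
  (forall k, b k != 0%N -> x k != 0) ->
  `|\prod_k x k ^+ b k| = expR (log_monomial x b).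
Proof.
move=> xb; rewrite expR_sum normr_prod; apply: eq_bigr => k _.
rewrite expRM_natl normrX; have [->|/xb xk] := eqVneq (b k) 0%N.
  by rewrite !expr0.
by rewrite lnK// posrE normr_gt0.
Qed.

(** The tangent line of the exponential at the weighted mean of the [u i] lies
    below its graph. *)
Lemma expR_jensen I (lam u : I -> R) :
  (forall i, 0 <= lam i) -> \sum_i lam i = 1 ->
  expR (\sum_i lam i * u i) <= \sum_i lam i * expR (u i).
Proof.
move=> lam0 lam1; set v := \sum_i lam i * u i.
have -> : expR v = \sum_i lam i * (expR v * (1 + (u i - v))).
  under eq_bigr do rewrite mulrCA mulrDr mulr1 mulrBr.
  rewrite -mulr_sumr big_split sumrB /= -mulr_suml -/v lam1.
  by rewrite mul1r subrr addr0 mulr1.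
apply: ler_sum => i _; rewrite ler_wpM2l//.
rewrite -[u i in leRHS](subrKC v) expRD ler_wpM2l ?expR_ge0//.
exact: expR_ge1Dx.
Qed.

Definition barycentric I (a : I -> 'X_{1..n}) b (lam : I -> R) : Prop :=
  [/\ forall i, 0 <= lam i, \sum_i lam i = 1
    & forall k, \sum_i lam i * (a i k)%:R = (b k)%:R].

Lemma barycentric_support I (a : I -> 'X_{1..n}) b (lam : I -> R) i k :
  barycentric a b lam -> lam i != 0 -> a i k != 0%N -> b k != 0%N.
Proof.
move=> [lam0 _ bary] lami aik; rewrite -(eqr_nat R) -bary.
have h j : true -> 0 <= lam j * (a j k)%:R by rewrite mulr_ge0.
rewrite psumr_neq0//; apply/hasP; exists i; first exact: mem_index_enum.
by rewrite /= lt_neqAle h// andbT eq_sym mulf_neq0// pnatr_eq0.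
Qed.

Lemma barycentric_log I (a : I -> 'X_{1..n}) b (lam : I -> R) x :
  barycentric a b lam ->
  \sum_i lam i * log_monomial x (a i) = log_monomial x b.
Proof.
move=> [_ _ bary]; under eq_bigr do rewrite mulr_sumr.
rewrite exchange_big; apply: eq_bigr => k _ /=.
by rewrite -bary mulr_suml; apply: eq_bigr => i _; rewrite mulrA.
Qed.

(** The coefficients are parametrized as [lam i * expR (u i)] so that the
    critical value of [d], a weighted geometric mean, is
    [expR (\sum_i lam i * u i)], and exponents of weight 0 drop out. *)
Definition amgm_poly I (a : I -> 'X_{1..n}) b (lam u : I -> R) (d : R) :
    {mpoly R[n]} :=
  \sum_i (lam i * expR (u i)) *: 'X_[a i] + d *: 'X_[b].

(** Weighted AM-GM. Where the monomial [X^b] vanishes there is nothing to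
    compare. Elsewhere every variable occurring in an exponent of nonzero
    weight is nonzero, because it also occurs in [b], so logarithms can be
    taken and Jensen's inequality applies. *)
Lemma amgm_nonneg I (a : I -> 'X_{1..n}) b (lam u : I -> R) d :
  barycentric a b lam -> (forall i, even_exponent (a i)) ->
  `|d| <= expR (\sum_i lam i * u i) -> nonneg_poly (amgm_poly a b lam u d).
Proof.
move=> bary ev d_le x; have [lam0 lam1 _] := bary.
rewrite mevalD mevalZ mevalX raddf_sum /=.
under eq_bigr do rewrite mevalZ mevalX.
have [xb|] := pselect (forall k, b k != 0%N -> x k != 0); last first.
  move=> /existsNP[k /not_implyP[bk /negP]]; rewrite negbK => /eqP xk.
  rewrite (bigD1 k)//= [in X in _ + X]xk expr0n (negbTE bk) mul0r mulr0 addr0.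
  by apply: sumr_ge0 => i _; rewrite !mulr_ge0// ?expR_ge0// even_monomial_ge0.
rewrite -[X in _ + X]opprK subr_ge0 (le_trans (ler_norm _))// normrN normrM.
rewrite (normr_monomial xb) -(barycentric_log _ bary).
apply: (le_trans (ler_wpM2r (expR_ge0 _) d_le)).
rewrite -expRD -big_split /=; under eq_bigr do rewrite -mulrDr.
apply: (le_trans (expR_jensen _ lam0 lam1)).
apply: ler_sum => i _; rewrite -mulrA.
have [->|lami] := eqVneq (lam i) 0; first by rewrite !mul0r.
rewrite expRD -normr_monomial ?ger0_norm ?even_monomial_ge0//.
by move=> k aik; apply: xb; exact: barycentric_support bary lami aik.
Qed.

End WeightedAMGM.

(** * Circuits and barycentric coordinates *)

Section Circuits.
Variables (R : realType) (n : nat).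
Implicit Types (S : {fset 'X_{1..n}}) (b : 'X_{1..n}).

Local Notation pt := (@exponent_point R n).

(** Barycentric coordinates as affine functions on the whole space. Affine
    independence means that the rows [(a, 1)], [a] in [S], are linearly
    independent, so the matrix they form has a right inverse, whose columns are
    the coordinate functions. *)
Lemma dual_basis S : affinely_independent R S ->
  exists (v : S -> 'rV[R]_n) (r : S -> R), forall s t : S,
    dot (pt (val t)) (v s) + r s = (t == s)%:R.
Proof.
move=> indep.
pose M : 'M[R]_(#|{: S}|, n + 1) :=
  \matrix_(i < #|{: S}|) row_mx (pt (val (enum_val i))) 1.
have : row_free M.
  apply: inj_row_free => w wM.
  pose c (a : 'X_{1..n}) :=
    if insub a is Some s then w ord0 (enum_rank (s : S)) else 0.
  have cE (s : S) : c (val s) = w ord0 (enum_rank s) by rewrite /c valK.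
  have sumS (V : zmodType) (F : S -> V) :
      \sum_(s : S) F s = \sum_(i < #|{: S}|) F (enum_val i).
    by rewrite (big_enum_val (A := {: S})).
  have : row_mx (\sum_(a <- S) c a *: pt a) (\sum_(a <- S) c a)%:M = 0
      :> 'rV[R]_(n + 1).
    rewrite !big_seq_fsetE /= !sumS -wM mulmx_sum_row.
    rewrite raddf_sum /=.
    have row_mx_sum (V : Type) (s : seq V) (F : V -> 'rV[R]_n)
        (G : V -> 'rV[R]_1) :
        row_mx (\sum_(i <- s) F i) (\sum_(i <- s) G i) =
        \sum_(i <- s) row_mx (F i) (G i).
      elim: s => [|i s IH]; first by rewrite !big_nil row_mx0.
      by rewrite !big_cons -IH add_row_mx.
    rewrite row_mx_sum; apply: eq_bigr => i _.
    by rewrite cE enum_valK rowK scale_row_mx scalemx1.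
  move=> /(congr1 (fun u => (lsubmx u, rsubmx u))).
  rewrite row_mxKl row_mxKr !linear0 => -[c_pt c_sum].
  have {}c_sum : \sum_(a <- S) c a = 0.
    by move: c_sum => /matrixP/(_ ord0 ord0); rewrite !mxE eqxx mulr1n.
  apply/rowP => i; rewrite mxE.
  by have := indep c c_sum c_pt _ (valP (enum_val i)); rewrite cE enum_valK.
move=> /row_freeP[B MB].
exists (fun s => \row_k B (lshift 1 k) (enum_rank s)),
  (fun s => B (rshift n ord0) (enum_rank s)) => s t.
have := congr1 (fun A : 'M_#|{: S}| => A (enum_rank t) (enum_rank s)) MB.
rewrite [1%:M _ _]mxE (inj_eq enum_rank_inj) => <-.
rewrite mxE big_split_ord big_ord1 [M _ (rshift _ _)]mxE enum_rankK row_mxEr.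
rewrite mxE mul1r; congr (_ + _); apply: eq_bigr => k _.
by rewrite [M _ _]mxE enum_rankK row_mxEl [X in _ * X]mxE.
Qed.

Lemma convex_hull_ptsP S (y : 'rV[R]_n) :
  convex_hull [set pt a | a in [set` S]] y <->
  exists c : S -> R, [/\ forall s, 0 <= c s, \sum_s c s = 1
    & y = \sum_s c s *: pt (val s)].
Proof.
split=> [[N [p [c [pS c0 c1 ->]]]]|[c [c0 c1 ->]]].
  have [al alE] : {al : 'I_N -> S & forall i, p i = pt (val (al i))}.
    apply: (@choice _ _ (fun i (s : S) => p i = pt (val s))) => i.
    by have [a aS <-] := pS i; exists [` aS]%fset.
  exists (fun s => \sum_(i | al i == s) c i); split.
  - by move=> s; apply: sumr_ge0.
  - by rewrite -c1 [RHS](partition_big al xpredT).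
  rewrite (partition_big al xpredT)//=; apply: eq_bigr => s _.
  by rewrite scaler_suml; apply: eq_bigr => i /eqP <-; rewrite alE.
exists #|{: S}|, (fun i => pt (val (enum_val i))), (c \o enum_val); split.
- by move=> i; exists (val (enum_val i)) => //; exact: valP.
- by move=> i; apply: c0.
- by rewrite -c1 [RHS](big_enum_val (A := {: S})).
- by rewrite [LHS](big_enum_val (A := {: S})).
Qed.

Lemma affine_hull_pts S (y : 'rV[R]_n) :
  affine_hull (convex_hull [set pt a | a in [set` S]]) y ->
  exists2 c : S -> R, \sum_s c s = 1 & y = \sum_s c s *: pt (val s).
Proof.
move=> [N [p [c [pS c1 ->]]]].
have [e eP] := choice (fun i => (convex_hull_ptsP S (p i)).1 (pS i)).
exists (fun s => \sum_i c i * e i s).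
  rewrite exchange_big -c1; apply: eq_bigr => i _ /=.
  by have [_ e1 _] := eP i; rewrite -mulr_sumr e1 mulr1.
under [RHS]eq_bigr do rewrite scaler_suml.
rewrite exchange_big; apply: eq_bigr => i _ /=.
have [_ _ {1}->] := eP i.
by rewrite scaler_sumr; apply: eq_bigr => s _; rewrite scalerA.
Qed.

(** Barycentric coordinates are continuous, so they stay positive on the affine
    hull of [S] near a point whose coordinates are all positive: such a point
    is interior to the simplex spanned by [S]. *)
Lemma circuit_of_positive_weights S b (c : S -> R) :
  affinely_independent R S -> b \notin S -> (forall s, 0 < c s) ->
  \sum_s c s = 1 -> pt b = \sum_s c s *: pt (val s) -> circuit R S b.
Proof.
move=> indep bS c0 c1 bE; split=> //; split.
  by apply/convex_hull_ptsP; exists c; split=> // s; exact: ltW.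
have [v [r dual]] := dual_basis indep.
have coord (e : S -> R) s : \sum_t e t = 1 ->
    dot (\sum_t e t *: pt (val t)) (v s) + r s = e s.
  move=> e1; rewrite dot_suml -[r s]mul1r -e1 mulr_suml -big_split /=.
  under eq_bigr do rewrite dotZl -mulrDr dual.
  rewrite (bigD1 s)//= eqxx mulr1 big1 ?addr0// => t /negbTE ->.
  by rewrite mulr0.
have pos : \forall y \near pt b, forall s : S, - r s < dot y (v s).
  apply: (@filter_forall _ S _ (nbhs (pt b))) => s.
  have cdot : continuous (fun y : 'rV[R]_n => dot y (v s)).
    by apply: continuous_dot => i; exact: coord_continuous.
  have := cdot (pt b); rewrite /= => /cvgr_gt; apply.
  by rewrite -subr_gt0 opprK bE coord.
apply: filterS pos => y pos aff_y.
have [e e1 yE] := affine_hull_pts aff_y.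
apply/convex_hull_ptsP; exists e; split=> // s.
by have := pos s; rewrite -subr_gt0 opprK yE coord// => /ltW.
Qed.

End Circuits.

(** * Decomposing AM-GM polynomials into circuit polynomials *)

Section Decomposition.
Variables (R : realType) (n : nat).
Implicit Types (I : finType) (b : 'X_{1..n}).

Local Notation pt := (@exponent_point R n).

Lemma sum_delta I (V : lmodType R) (F : I -> V) j :
  \sum_i (i == j)%:R *: F i = F j.
Proof.
rewrite (bigD1 j)//= eqxx scale1r big1 ?addr0// => i /negbTE ->.
by rewrite scale0r.
Qed.

(** When the exponents of nonzero weight are affinely independent they are
    pairwise distinct, and two cases remain. If [b] is one of them, then all the
    weight is on [b] and the polynomial is a monomial square. Otherwise these
    exponents and [b] form a circuit. *)
Lemma sonc_amgm_independent I (a : I -> 'X_{1..n}) b (lam u : I -> R) d :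
  barycentric a b lam -> (forall i, even_exponent (a i)) ->
  `|d| <= expR (\sum_i lam i * u i) ->
  (forall nu : I -> R, (forall i, lam i = 0 -> nu i = 0) -> \sum_i nu i = 0 ->
     \sum_i nu i *: pt (a i) = 0 -> forall i, nu i = 0) ->
  sonc (amgm_poly a b lam u d).
Proof.
move=> bary ev d_le indep; have [lam0 lam1 lamb] := bary.
have nonneg := amgm_nonneg bary ev d_le.
have ptE : \sum_i lam i *: pt (a i) = pt b.
  apply/rowP => k; rewrite summxE mxE -lamb.
  by apply: eq_bigr => i _; rewrite !mxE.
have sum_supp (V : nmodType) (F : I -> V) : (forall i, lam i = 0 -> F i = 0) ->
    \sum_i F i = \sum_(i | lam i != 0) F i.
  move=> F0; rewrite [RHS]big_mkcond; apply: eq_bigr => i _.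
  by case: eqVneq => // /F0.
have ainj : {in [pred i | lam i != 0] &, injective a}.
  move=> i j; rewrite !inE => li lj aij; apply/eqP/negP => /negP i_j.
  (* Equal exponents at two indices would be an affine dependency. *)
  pose nu k : R := (k == i)%:R - (k == j)%:R.
  have h (V : lmodType R) (F : I -> V) : \sum_k nu k *: F k = F i - F j.
    under eq_bigr do rewrite scalerBl.
    by rewrite sumrB !sum_delta.
  have := indep nu _ _ _ i; rewrite /nu eqxx (negbTE i_j) subr0 => nui.
  suff : (1 : R) = 0 by move/eqP; rewrite oner_eq0.
  apply: nui => [k lk||].
  - have /negbTE -> : k != i by apply: contraNneq li => <-; rewrite lk.
    have /negbTE -> : k != j by apply: contraNneq lj => <-; rewrite lk.
    by rewrite subrr.
  - rewrite -[RHS](subrr (1 : R)) -(h R^o (fun=> 1)).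
    by apply: eq_bigr => k _; rewrite /GRing.scale /= mulr1.
  - by rewrite h aij subrr.
pose S := [fset a i | i in [pred i | lam i != 0]]%fset.
have sumS (V : nmodType) (F : 'X_{1..n} -> V) :
    \sum_(e <- S) F e = \sum_(i | lam i != 0) F (a i).
  by rewrite big_imfset//= big_enum.
have [bS|bS] := boolP (b \in S).
  have /imfsetP[/= i0 li0 bE] := bS.
  (* [lam] and the point mass at [i0] have the same barycentre [b]. *)
  have lamE i : lam i = (i == i0)%:R.
    apply/eqP; rewrite -subr_eq0; apply/eqP; move: i.
    apply: indep => [i li||].
    - rewrite li; case: eqVneq => [ii0|]; last by rewrite subrr.
      by have : lam i0 != 0 := li0; rewrite -ii0 li eqxx.
    - rewrite sumrB lam1 (bigD1 i0)//= eqxx big1 ?addr0 ?subrr//.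
      by move=> k /negbTE ->.
    - under eq_bigr do rewrite scalerBl.
      by rewrite sumrB sum_delta ptE bE subrr.
  have sumE (V : nmodType) (F : I -> V) : (forall i, lam i = 0 -> F i = 0) ->
      \sum_i F i = F i0.
    move=> F0; rewrite (bigD1 i0)//= big1 ?addr0// => i /negbTE ii0.
    by apply: F0; rewrite lamE ii0.
  have -> : amgm_poly a b lam u d = (expR (u i0) + d) *: 'X_[b].
    rewrite /amgm_poly sumE => [|i ->]; last by rewrite mul0r scale0r.
    by rewrite lamE eqxx mul1r bE -scalerDl.
  apply: sonc_monomial_square; last by rewrite bE.
  move: d_le; rewrite sumE => [|i ->]; last by rewrite mul0r.
  by rewrite lamE eqxx mul1r ler_norml => /andP[+ _]; rewrite -lerBlDl sub0r.
apply: sonc_circuit nonneg; right.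
(* The circuit is indexed by exponents instead of indices; by injectivity of
   [a] each of these sums has a single term. *)
pose c e : R := \sum_(i | (lam i != 0) && (a i == e)) lam i * expR (u i).
pose w e : R := \sum_(i | (lam i != 0) && (a i == e)) lam i.
have at_a (F : I -> R) i : lam i != 0 ->
    \sum_(j | (lam j != 0) && (a j == a i)) F j = F i.
  move=> li; rewrite (big_pred1 i)// => j /=.
  apply/andP/eqP => [[lj /eqP aji]|->]; last by [].
  exact: ainj.
have inS e : e \in S -> exists2 i, lam i != 0 & e = a i.
  by move=> /imfsetP[/= i]; exists i.
exists S, b, c, d; split.
- apply: (@circuit_of_positive_weights _ _ S b (w \o val)) => //.
  + move=> e e_sum e_pt x /inS[i li ->].
    move: e_sum e_pt; rewrite !sumS => e_sum e_pt.
    pose nu i := if lam i == 0 then 0 else e (a i).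
    have := indep nu _ _ _ i; rewrite /nu (negbTE li); apply.
    * by move=> j ->; rewrite eqxx.
    * rewrite sum_supp => [|j ->]; last by rewrite eqxx.
      by rewrite -[RHS]e_sum; apply: eq_bigr => j /negbTE ->.
    * rewrite sum_supp => [|j ->]; last by rewrite eqxx scale0r.
      by rewrite -[RHS]e_pt; apply: eq_bigr => j /negbTE ->.
  + move=> s /=; have [i li ->] := inS _ (valP s).
    by rewrite /w at_a// lt_neqAle eq_sym li lam0.
  + rewrite -(big_seq_fsetE _ S xpredT w) sumS -lam1 [RHS]sum_supp//.
    by apply: eq_bigr => i li; rewrite /w at_a.
  + rewrite -(big_seq_fsetE _ S xpredT (fun e => w e *: pt e)) sumS -ptE.
    rewrite sum_supp => [|i ->]; last by rewrite scale0r.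
    by apply: eq_bigr => i li; rewrite /w at_a.
- by move=> e /inS[i _ ->].
- move=> e /inS[i li ->]; rewrite /c at_a//.
  by rewrite mulr_gt0 ?expR_gt0// lt_neqAle eq_sym li lam0.
- congr (_ + _); rewrite sumS sum_supp => [|i ->].
  2: by rewrite mul0r scale0r.
  by apply: eq_bigr => i li; rewrite /c at_a.
Qed.

(** Moving from [lam] in the direction [nu], the first coordinate to reach 0 is
    the one minimizing [lam i / - nu i] among those that decrease. *)
Lemma step_to_boundary I (lam nu : I -> R) :
  (forall i, 0 <= lam i) -> (forall i, lam i = 0 -> nu i = 0) ->
  (exists i, nu i < 0) ->
  exists t : R, [/\ 0 < t, forall i, 0 <= lam i + t * nu i
    & exists2 i, lam i != 0 & lam i + t * nu i = 0].
Proof.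
move=> lam0 supp [i0 nui0].
case: (@Order.TotalTheory.arg_minP _ _ _ i0 (fun i => nu i < 0)
  (fun i => lam i / - nu i) nui0) => i nui imin.
have li : lam i != 0 by apply: contraTneq nui => /supp ->; rewrite ltxx.
have lam_gt0 : 0 < lam i by rewrite lt_neqAle eq_sym li lam0.
have nuN : 0 < - nu i by rewrite oppr_gt0.
exists (lam i / - nu i); split; first by rewrite divr_gt0.
- move=> j; have [nuj|nuj] := ltP (nu j) 0.
    have := imin j nuj; rewrite ler_pdivlMr ?oppr_gt0//.
    by rewrite mulrN lerNl -subr_ge0 opprK addrC.
  by rewrite addr_ge0// mulr_ge0// divr_ge0// ltW.
- by exists i => //; rewrite invrN mulrN mulNr divfK ?subrr// lt_eqF.
Qed.

(** Induction on the number of nonzero weights. An affine dependency [nu] among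
    the exponents of nonzero weight lets one move [lam] in the directions [nu]
    and [- nu] without changing the barycentre, until some weight vanishes.
    Then [lam = th * mu1 + th' * mu2] with [mu1], [mu2] of smaller support, and
    [d] is distributed in proportion to [th * E1] and [th' * E2], where [E1] and
    [E2] are the critical values for [mu1] and [mu2]; convexity of the
    exponential says that together they leave enough room for [d]. *)
Lemma sonc_amgm I (a : I -> 'X_{1..n}) b (lam u : I -> R) d :
  barycentric a b lam -> (forall i, even_exponent (a i)) ->
  `|d| <= expR (\sum_i lam i * u i) -> sonc (amgm_poly a b lam u d).
Proof.
move=> + ev.
have [N] := ubnP #|[pred i | lam i != 0]|.
elim: N lam d => // N IH lam d leN bary d_le; have [lam0 lam1 lamb] := bary.
have [indep|] := pselect (forall nu : I -> R,
    (forall i, lam i = 0 -> nu i = 0) -> \sum_i nu i = 0 ->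
    \sum_i nu i *: pt (a i) = 0 -> forall i, nu i = 0).
  exact: sonc_amgm_independent.
move=> /existsNP[nu /not_implyP[supp /not_implyP[nu_sum /not_implyP[nu_pt]]]].
move=> /existsNP[i0 /eqP nui0].
have nu_bary k : \sum_i nu i * (a i k)%:R = 0.
  move/rowP/(_ k): nu_pt; rewrite summxE mxE => {2}<-.
  by apply: eq_bigr => i _; rewrite !mxE.
have neg (mu : I -> R) : \sum_i mu i = 0 -> mu i0 != 0 -> exists i, mu i < 0.
  move=> mu_sum mui0; apply: contrapT => /forallNP mu_ge0.
  have {}mu_ge0 i : true -> 0 <= mu i by rewrite leNgt => _; apply/negP/mu_ge0.
  move/eqP: mu_sum; rewrite psumr_eq0// => /allP/(_ i0 (mem_index_enum _)).
  by rewrite /= (negbTE mui0).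
have [t1 [t1_gt0 mu1_ge0 [i1 li1 mu1_i1]]] :=
  step_to_boundary lam0 supp (neg _ nu_sum nui0).
have [||t2 [t2_gt0 mu2_ge0 [i2 li2 mu2_i2]]] :=
  @step_to_boundary _ lam (fun i => - nu i) lam0.
- by move=> i /supp ->; rewrite oppr0.
- by apply: neg; rewrite ?oppr_eq0// sumrN nu_sum oppr0.
pose mu1 i := lam i + t1 * nu i; pose mu2 i := lam i + t2 * - nu i.
have bary1 (mu : I -> R) (t : R) : (forall i, 0 <= lam i + t * mu i) ->
    \sum_i mu i = 0 -> (forall k, \sum_i mu i * (a i k)%:R = 0) ->
    barycentric a b (fun i => lam i + t * mu i).
  move=> mu_ge0 mu_sum mu_bary; split=> //.
    by rewrite big_split /= -mulr_sumr mu_sum mulr0 addr0.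
  move=> k; under eq_bigr do rewrite mulrDl -mulrA.
  by rewrite big_split /= -mulr_sumr mu_bary mulr0 addr0.
have smaller (mu : I -> R) i : (forall j, lam j = 0 -> mu j = 0) ->
    lam i != 0 -> mu i = 0 -> (#|[pred i | mu i != 0%R]| < N)%N.
  move=> mu_supp li mui; rewrite -ltnS; apply: leq_trans leN; rewrite ltnS.
  apply: proper_card; apply/properP; split.
    apply/fintype.subsetP => j; rewrite !inE.
    by apply: contraNneq => /mu_supp ->.
  by exists i; rewrite !inE ?li// mui eqxx.
pose th := t2 / (t1 + t2); pose th' := t1 / (t1 + t2).
have t_gt0 : 0 < t1 + t2 by rewrite addr_gt0.
have th_gt0 : 0 < th by rewrite divr_gt0.
have th'_gt0 : 0 < th' by rewrite divr_gt0.
have th_sum : th + th' = 1 by rewrite -mulrDl addrC divff// gt_eqF.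
have lamE i : lam i = th * mu1 i + th' * mu2 i.
  by rewrite /mu1 /mu2 /th /th'; field; rewrite gt_eqF.
pose E1 := expR (\sum_i mu1 i * u i); pose E2 := expR (\sum_i mu2 i * u i).
have E1_gt0 : 0 < E1 := expR_gt0 _; have E2_gt0 : 0 < E2 := expR_gt0 _.
pose E := th * E1 + th' * E2.
have E_gt0 : 0 < E by rewrite addr_gt0// mulr_gt0.
have d_leE : `|d| <= E.
  apply: le_trans d_le _.
  have := @expR_jensen R bool (fun x => if x then th else th')
    (fun x => if x then \sum_i mu1 i * u i else \sum_i mu2 i * u i).
  rewrite !big_bool /= => /(_ _ th_sum) jensen; apply: le_trans (jensen _).
    2: by case; exact: ltW.
  rewrite !mulr_sumr -big_split ler_expR; apply: ler_sum => i _ /=.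
  by rewrite lamE mulrDl !mulrA.
have part (F : R) : 0 < F -> `|d * (F / E)| <= F.
  move=> F_gt0; rewrite normrM (gtr0_norm (divr_gt0 F_gt0 E_gt0)).
  by rewrite mulrCA ger_pMr// ler_pdivrMr// mul1r.
have -> : amgm_poly a b lam u d =
    th *: amgm_poly a b mu1 u (d * (E1 / E)) +
    th' *: amgm_poly a b mu2 u (d * (E2 / E)).
  rewrite /amgm_poly !scalerDr !scaler_sumr addrACA -big_split /= !scalerA.
  rewrite -scalerDl; congr (_ + _ *: _).
    apply: eq_bigr => i _; rewrite !scalerA -scalerDl; congr (_ *: _).
    by rewrite lamE mulrDl !mulrA.
  rewrite !(mulrCA _ d) -mulrDr.
  have -> : th * (E1 / E) + th' * (E2 / E) = 1; last by rewrite mulr1.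
  by rewrite !mulrA -mulrDl -/E divff// lt0r_neq0.
apply: soncD; apply: soncZ; try exact: ltW.
  apply: IH; [|exact: bary1|exact: part].
  by apply: (smaller _ i1) => // i li; rewrite /mu1 li supp// mulr0 addr0.
apply: IH; [| |exact: part].
  apply: (smaller _ i2) => // i li.
  by rewrite /mu2 li supp// oppr0 mulr0 addr0.
apply: bary1 => //; first by rewrite sumrN nu_sum oppr0.
by move=> k; under eq_bigr do rewrite mulNr; rewrite sumrN nu_bary oppr0.
Qed.

Lemma sonc_dominated I (a : I -> 'X_{1..n}) b (lam u c : I -> R) d :
  barycentric a b lam -> (forall i, even_exponent (a i)) ->
  (forall i, lam i * expR (u i) <= c i) ->
  `|d| <= expR (\sum_i lam i * u i) ->
  sonc (\sum_i c i *: 'X_[a i] + d *: 'X_[b]).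
Proof.
move=> bary ev c_ge d_le.
have -> : \sum_i c i *: 'X_[a i] + d *: 'X_[b] =
    \sum_i (c i - lam i * expR (u i)) *: 'X_[a i] + amgm_poly a b lam u d.
  rewrite /amgm_poly addrA -big_split /=; congr (_ + _).
  by apply: eq_bigr => i _; rewrite -scalerDl subrK.
apply: soncD; last exact: sonc_amgm.
by apply: sonc_sum => i _; apply: sonc_monomial_square; rewrite ?subr_ge0.
Qed.

End Decomposition.

(** * The circuit number bound *)

Section CircuitBound.
Variables (R : realType) (n : nat).
Implicit Types (S : {fset 'X_{1..n}}) (b : 'X_{1..n}).

Local Notation pt := (@exponent_point R n).

Lemma monomial_expR (sg : 'I_n -> R) (z : 'rV[R]_n) (a : 'X_{1..n}) :
  \prod_k (sg k * expR (z ord0 k)) ^+ a k =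
  (\prod_k sg k ^+ a k) * expR (dot (pt a) z).
Proof.
rewrite expR_sum -big_split; apply: eq_bigr => k _ /=.
by rewrite exprMn mxE expRM_natl.
Qed.

(** A choice of signs makes the inner term of a circuit polynomial negative
    without affecting the outer terms, unless that term is a monomial square:
    flip one variable that has an odd exponent in [b]. *)
Lemma negating_signs b (d : R) : ~ (even_exponent b /\ 0 <= d) ->
  exists sg : 'I_n -> R, [/\ d * \prod_k sg k ^+ b k = - `|d|
    & forall a : 'X_{1..n}, even_exponent a -> \prod_k sg k ^+ a k = 1].
Proof.
move=> nbd; have [d0|d0] := ltP d 0.
  exists (fun=> 1); split=> [|a _].
    by rewrite big1 => [|k _]; rewrite ?expr1n// mulr1 ltr0_norm ?opprK.
  by rewrite big1 => // k _; rewrite expr1n.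
have /forallPn[k0 /negPn odd_k0] : ~~ even_exponent b.
  by apply/negP => ev; apply: nbd.
exists (fun k => if k == k0 then -1 else 1); split=> [|a /forallP ev].
  rewrite ger0_norm// (bigD1 k0)//= eqxx big1 => [|k /negbTE ->].
    by rewrite -signr_odd odd_k0 expr1 mulr1 mulrN1.
  by rewrite expr1n.
rewrite big1 => // k _; case: ifP => _; last by rewrite expr1n.
by rewrite -signr_odd (negbTE (ev k)) expr0.
Qed.

(** By affine independence there is a point [z] of logarithmic coordinates at
    which the monomials [X^s], [s] in [S], take the values [expR (tau s)] up to
    the common factor [expR (- r0)]. Evaluate there, with signs that make the
    inner term negative. *)
Lemma circuit_dominates S b (c : 'X_{1..n} -> R) d (lam tau : S -> R) :
  affinely_independent R S -> (forall a, a \in S -> even_exponent a) ->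
  nonneg_poly (\sum_(a <- S) c a *: 'X_[a] + d *: 'X_[b]) ->
  ~ (even_exponent b /\ 0 <= d) ->
  \sum_s lam s = 1 -> pt b = \sum_s lam s *: pt (val s) ->
  `|d| * expR (\sum_s lam s * tau s) <= \sum_s c (val s) * expR (tau s).
Proof.
move=> indep ev nonneg nbd lam1 bE.
have [sg [sg_b sg_ev]] := negating_signs nbd.
have [v [r dual]] := dual_basis indep.
pose z := \sum_s tau s *: v s; pose r0 := \sum_s tau s * r s.
have dotz s : dot (pt (val s)) z = tau s - r0.
  have dot_sumr (w : 'rV[R]_n) : dot w z = \sum_s tau s * dot w (v s).
    rewrite /z; elim/big_rec2: _ => [|t x y _ <-].
      by rewrite -(scale0r 0) dotZr mul0r.
    by rewrite dotDr dotZr.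
  rewrite dot_sumr; apply/eqP; rewrite eq_sym subr_eq; apply/eqP.
  rewrite -big_split /= (bigD1 s)//= -mulrDr dual eqxx mulr1 big1 ?addr0//.
  by move=> t /negbTE ts; rewrite -mulrDr dual eq_sym ts mulr0.
have dotb : dot (pt b) z = \sum_s lam s * tau s - r0.
  rewrite bE dot_suml; under eq_bigr do rewrite dotZl dotz mulrBr.
  by rewrite sumrB -mulr_suml lam1 mul1r.
have := nonneg (fun k => sg k * expR (z ord0 k)).
rewrite mevalD mevalZ mevalX monomial_expR mulrA sg_b mulNr subr_ge0 dotb.
rewrite big_seq_fsetE (raddf_sum (meval _)) /=.
rewrite expRB mulrA ler_pdivrMr ?expR_gt0// => /le_trans; apply.
rewrite mulr_suml; apply: ler_sum => s _; rewrite mevalZ mevalX monomial_expR.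
by rewrite sg_ev ?ev ?fsvalP// mul1r dotz expRB mulrA divfK ?gt_eqF ?expR_gt0.
Qed.

(** Equalizing the outer terms relative to their weights, that is taking
    [tau s = ln (lam s / c s)] in [circuit_dominates], gives the bound on [d].
    For a vertex of weight 0 this has no meaning; its term is made
    arbitrarily small instead, and one passes to the limit. *)
Lemma circuit_bound S b (c : 'X_{1..n} -> R) d :
  circuit R S b -> (forall a, a \in S -> even_exponent a) ->
  (forall a, a \in S -> 0 < c a) ->
  nonneg_poly (\sum_(a <- S) c a *: 'X_[a] + d *: 'X_[b]) ->
  ~ (even_exponent b /\ 0 <= d) ->
  exists lam u : S -> R, [/\ barycentric (fun s : S => val s) b lam,
    forall s, lam s * expR (u s) <= c (val s)
    & `|d| <= expR (\sum_s lam s * u s)].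
Proof.
move=> [indep _ [/convex_hull_ptsP[lam [lam0 lam1 bE]] _]] ev c_gt0 nonneg nbd.
have {}c_gt0 (s : S) : 0 < c (val s) by apply: c_gt0; exact: valP.
have lam_gt0 s : lam s != 0 -> 0 < lam s.
  by rewrite lt_neqAle eq_sym lam0 => ->.
pose u s := ln (c (val s) / lam s).
exists lam, u; split.
- split=> // k; move/rowP/(_ k): bE; rewrite summxE mxE => ->.
  by apply: eq_bigr => s _; rewrite !mxE.
- move=> s; have [->|ls] := eqVneq (lam s) 0; first by rewrite mul0r ltW.
  by rewrite lnK ?posrE ?divr_gt0 ?lam_gt0// mulrC divfK.
have -> : \sum_s lam s * u s = - \sum_s lam s * - u s.
  by rewrite -sumrN; apply: eq_bigr => s _; rewrite mulrN opprK.
rewrite expRN -[leRHS]mul1r ler_pdivlMr ?expR_gt0//.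
apply/ler_addgt0Pr => e e_gt0.
pose N : R := #|{: S}|%:R + 1.
have N_gt0 : 0 < N by rewrite ltr_wpDl.
pose e' := e / N; have e'_gt0 : 0 < e' by rewrite divr_gt0.
pose tau s := if lam s == 0 then ln (e' / c (val s)) else - u s.
have -> : \sum_s lam s * - u s = \sum_s lam s * tau s.
  by apply: eq_bigr => s _; rewrite /tau; case: eqP => // ->; rewrite !mul0r.
apply: (le_trans (circuit_dominates _ indep ev nonneg nbd lam1 bE)).
apply: (@le_trans _ _ (\sum_s (lam s + e'))).
  apply: ler_sum => s _; rewrite /tau; case: eqVneq => [->|ls].
    by rewrite lnK ?posrE ?divr_gt0// mulrC divfK ?gt_eqF// add0r.
  rewrite expRN lnK ?posrE ?divr_gt0 ?lam_gt0// invf_div mulrC divfK ?gt_eqF//.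
  by rewrite lerDl ltW.
rewrite big_split /= lam1 lerD2l sumr_const -mulr_natl.
by rewrite /e' mulrA ler_pdivrMr// mulrC ler_pM2l// lerDl.
Qed.

End CircuitBound.

(** * Fixing the values of some variables *)

Section Substitution.
Variables (R : realType) (n m : nat) (y : 'I_m -> R).

Definition fix_right : (n + m).-tuple {mpoly R[n]} :=
  [tuple match fintype.split i with inl j => 'X_j | inr j => (y j)%:MP end
    | i < n + m].

Definition left_exponent (a : 'X_{1..n + m}) : 'X_{1..n} :=
  [multinom a (lshift m i) | i < n].

Definition right_exponent (a : 'X_{1..n + m}) : 'X_{1..m} :=
  [multinom a (rshift n j) | j < m].

Lemma fix_right_lshift i : tnth fix_right (lshift m i) = 'X_i.
Proof. by rewrite tnth_mktuple (unsplitK (inl i)). Qed.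

Lemma fix_right_rshift j : tnth fix_right (rshift n j) = (y j)%:MP.
Proof. by rewrite tnth_mktuple (unsplitK (inr j)). Qed.

Lemma fix_right_monomial a :
  'X_[a] \mPo fix_right =
  (\prod_j y j ^+ right_exponent a j) *: 'X_[left_exponent a].
Proof.
rewrite comp_mpolyX big_split_ord /= -mul_mpolyC mulrC rmorph_prod.
congr (_ * _).
  by apply: eq_bigr => j _; rewrite fix_right_rshift rmorphXn /= mnmE.
by rewrite mpolyXE_id; apply: eq_bigr => i _; rewrite fix_right_lshift mnmE.
Qed.

Lemma even_left_exponent a : even_exponent a -> even_exponent (left_exponent a).
Proof. by move=> /forallP ev; apply/forallP => i; rewrite mnmE. Qed.

Lemma even_right_exponent a :
  even_exponent a -> even_exponent (right_exponent a).
Proof. by move=> /forallP ev; apply/forallP => i; rewrite mnmE. Qed.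

Lemma fix_right_monomial_square c a : 0 <= c -> even_exponent a ->
  sonc ((c *: 'X_[a]) \mPo fix_right).
Proof.
move=> c0 ev; rewrite comp_mpolyZ fix_right_monomial scalerA.
apply: sonc_monomial_square; last exact: even_left_exponent.
by rewrite mulr_ge0// even_monomial_ge0// even_right_exponent.
Qed.

(** If the frozen part of [X^b] vanishes, only monomial squares remain.
    Otherwise the frozen part of every exponent of nonzero weight is nonzero,
    and multiplying the coefficients by these values amounts to adding their
    logarithms to [u]; since taking logarithms of monomials commutes with
    barycentres, the bound on [d] is scaled in the same way as [d]. *)
Lemma fix_right_amgm (I : finType) (a : I -> 'X_{1..n + m}) b
    (lam u c : I -> R) d :
  barycentric a b lam -> (forall i, even_exponent (a i)) ->
  (forall i, lam i * expR (u i) <= c i) ->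
  `|d| <= expR (\sum_i lam i * u i) ->
  sonc ((\sum_i c i *: 'X_[a i] + d *: 'X_[b]) \mPo fix_right).
Proof.
move=> bary ev c_ge d_le; have [lam0 lam1 lamb] := bary.
have c0 i : 0 <= c i by rewrite (le_trans _ (c_ge i))// mulr_ge0 ?expR_ge0.
have bary_right : barycentric (right_exponent \o a) (right_exponent b) lam.
  split=> // j; rewrite mnmE -lamb.
  by apply: eq_bigr => i _; rewrite /= mnmE.
have bary_left : barycentric (left_exponent \o a) (left_exponent b) lam.
  split=> // j; rewrite mnmE -lamb.
  by apply: eq_bigr => i _; rewrite /= mnmE.
rewrite comp_mpolyD comp_mpolyZ fix_right_monomial scalerA raddf_sum /=.
have [yb|] := pselect (forall j, right_exponent b j != 0%N -> y j != 0).
2: {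
  move=> /existsNP[j /not_implyP[bj /negP]]; rewrite negbK => /eqP yj.
  rewrite (bigD1 j)//= [y j]yj expr0n (negbTE bj) mul0r mulr0 scale0r addr0.
  by apply: sonc_sum => i _; exact: fix_right_monomial_square. }
pose Y i := \prod_j y j ^+ right_exponent (a i) j.
have Y_ge0 i : 0 <= Y i by rewrite even_monomial_ge0// even_right_exponent.
have -> : \sum_i ((c i *: 'X_[a i]) \mPo fix_right) =
    \sum_i (c i * Y i) *: 'X_[(left_exponent \o a) i].
  by apply: eq_bigr => i _; rewrite comp_mpolyZ fix_right_monomial scalerA.
apply: (@sonc_dominated _ _ _ _ _ lam
  (fun i => u i + log_monomial y (right_exponent (a i)))) => //.
- by move=> i; exact: even_left_exponent.
- move=> i; have [li|li] := eqVneq (lam i) 0.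
    by rewrite li mul0r mulr_ge0.
  rewrite expRD mulrA -normr_monomial.
    by rewrite (ger0_norm (Y_ge0 i)) ler_wpM2r.
  move=> j aij; apply: yb.
  by apply: (barycentric_support bary_right li).
have -> : \sum_i lam i * (u i + log_monomial y (right_exponent (a i))) =
    \sum_i lam i * u i + log_monomial y (right_exponent b).
  rewrite -(barycentric_log _ bary_right) -big_split.
  by apply: eq_bigr => i _; rewrite mulrDr.
rewrite expRD normrM.
by rewrite normr_monomial// ler_wpM2r ?expR_ge0.
Qed.

Lemma sonc_fix_right p : sonc p -> sonc (p \mPo fix_right).
Proof.
move=> [N [w [q [w0 qc qn ->]]]]; rewrite raddf_sum; apply: sonc_sum => i _ /=.
rewrite comp_mpolyZ; apply: soncZ => //.
case: (qc i) (qn i) => [[M [s [sq ->]]] _|].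
  rewrite raddf_sum; apply: sonc_sum => j _ /=.
  have [c [a [c0 ev ->]]] := sq j.
  exact: fix_right_monomial_square.
move=> [S [b [c [d [circ ev c_gt0 ->]]]]] nonneg.
have [[evb d0]|nbd] := pselect (even_exponent b /\ 0 <= d).
  rewrite comp_mpolyD; apply: soncD; last exact: fix_right_monomial_square.
  rewrite big_seq raddf_sum; apply: sonc_sum => a aS /=.
  by apply: fix_right_monomial_square; [exact/ltW/c_gt0|exact: ev].
have [lam [u [bary c_ge d_le]]] := circuit_bound circ ev c_gt0 nonneg nbd.
rewrite big_seq_fsetE /=; apply: fix_right_amgm bary _ c_ge d_le => s.
by apply: ev; exact: valP.
Qed.

End Substitution.

(** * The first-order gap at a fixed base point *)

Section FirstOrderGap.
Variables (R : realType) (n : nat).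
Implicit Types h : {mpoly R[n]}.

Lemma comp_mpoly_comp (k l : nat) (p : {mpoly R[n]})
    (q : n.-tuple {mpoly R[k]}) (r : k.-tuple {mpoly R[l]}) :
  (p \mPo q) \mPo r = p \mPo [tuple tnth q i \mPo r | i < n].
Proof.
rewrite [p \mPo q]comp_mpolyE raddf_sum [RHS]comp_mpolyE.
apply: eq_bigr => a _ /=; rewrite comp_mpolyZ rmorph_prod; congr (_ *: _).
by apply: eq_bigr => i _; rewrite rmorphXn /= tnth_mktuple.
Qed.

Lemma comp_mpoly_const (k : nat) (p : {mpoly R[n]}) (y : 'I_n -> R) :
  p \mPo [tuple (y i)%:MP_[k] | i < n] = (p.@[y])%:MP.
Proof.
rewrite comp_mpolyE mevalE raddf_sum; apply: eq_bigr => a _ /=.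
rewrite mpolyCM -mul_mpolyC rmorph_prod; congr (_ * _).
by apply: eq_bigr => i _; rewrite tnth_mktuple rmorphXn.
Qed.

(** The linear term of the first-order expansion at [y], kept separate because
    it is linear in the gradient [v]. *)
Definition linear_form (v y : 'rV[R]_n) : {mpoly R[n]} :=
  \sum_i v ord0 i *: ('X_i - (y ord0 i)%:MP).

Lemma linear_formZ c v y : linear_form (c *: v) y = c *: linear_form v y.
Proof.
by rewrite scaler_sumr; apply: eq_bigr => i _; rewrite mxE scalerA.
Qed.

Lemma linear_formN v y : linear_form (- v) y = - linear_form v y.
Proof. by rewrite -scaleN1r linear_formZ scaleN1r. Qed.

Lemma linear_form_sum (I : Type) (r : seq I) (v : I -> 'rV[R]_n) y :
  linear_form (\sum_(j <- r) v j) y = \sum_(j <- r) linear_form (v j) y.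
Proof.
rewrite exchange_big; apply: eq_bigr => i _ /=.
by rewrite summxE scaler_suml.
Qed.

Lemma first_order_gap_at h (y : 'rV[R]_n) :
  first_order_gap h \mPo fix_right n (y ord0) =
  h - (h.@[y ord0])%:MP - linear_form (gradient h y) y.
Proof.
rewrite /first_order_gap !comp_mpolyB !comp_mpoly_comp.
have -> : [tuple tnth [tuple 'X_(lshift n i) | i < n] i
    \mPo fix_right n (y ord0) | i < n] = [tuple 'X_i | i < n].
  apply: eq_from_tnth => i.
  by rewrite !tnth_mktuple comp_mpolyXU -tnth_nth fix_right_lshift.
have yE : [tuple tnth [tuple 'X_(rshift n i) | i < n] i
    \mPo fix_right n (y ord0) | i < n] = [tuple (y ord0 i)%:MP_[n] | i < n].
  apply: eq_from_tnth => i.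
  by rewrite !tnth_mktuple comp_mpolyXU -tnth_nth fix_right_rshift.
rewrite yE comp_mpoly_id comp_mpoly_const (raddf_sum (comp_mpoly _)) /=.
congr (_ - _).
apply: eq_bigr => i _; rewrite rmorphM /= comp_mpoly_comp yE comp_mpoly_const.
rewrite comp_mpolyB !tnth_mktuple !comp_mpolyXU -!tnth_nth.
by rewrite fix_right_lshift fix_right_rshift mul_mpolyC mxE.
Qed.

Lemma sonc_gap_at k h (y : 'rV[R]_n) : first_order_sonc_convex k h ->
  sonc (h - (h.@[y ord0])%:MP - linear_form (gradient h y) y).
Proof.
by move=> [_ [_ hs]]; rewrite -first_order_gap_at; exact: sonc_fix_right.
Qed.

Lemma convex_of_sonc_convex k h : first_order_sonc_convex k h -> convex_poly h.
Proof.
move=> hk x y; have := sonc_nonneg (sonc_gap_at y hk) (x ord0).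
rewrite !mevalB mevalC /linear_form (raddf_sum (meval _)) /=.
rewrite (_ : \sum_i _ = dot (gradient h y) (x - y)); last first.
  apply: eq_bigr => i _; rewrite mevalZ mevalB mevalXU mevalC.
  by rewrite [(x - y) _ _]mxE [(- y) _ _]mxE.
by rewrite subr_ge0 lerBrDl.
Qed.

End FirstOrderGap.

(** * The Lagrangian *)

Section Lagrange.
Variables (R : realType) (n m : nat).

Lemma degree_le_linear d c (p q : {mpoly R[n]}) :
  degree_le d p -> degree_le d q -> degree_le d (p + c *: q).
Proof.
rewrite /degree_le /= => pd qd; apply: leq_trans (msizeD_le _ _) _.
by rewrite geq_max pd (leq_trans (msizeZ_le _ _)).
Qed.

(** The classical multipliers are placed at the indices [(e_j, 0)], whose
    product is [g j]; all other entries of [lambda] vanish. *)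
Lemma lagrange_multipliers (lam : 'I_m -> R) : (forall j, 0 <= lam j) ->
  exists2 lambda : lagrange_index m 1 -> R, forall ab, 0 <= lambda ab
    & forall (f : {mpoly R[n]}) (g : 'I_m -> {mpoly R[n]}),
        lagrange_polynomial f g lambda = f - \sum_j lam j *: g j.
Proof.
move=> lam0.
have unit_lt j : (mdeg (U_(j) : 'X_{1..m}) < 2)%N by rewrite mdeg1.
have zero_lt : (mdeg (0 : 'X_{1..m})%MM < 2)%N by rewrite mdeg0.
have idx_le j : (mdeg (U_(j) : 'X_{1..m}) + mdeg (0 : 'X_{1..m})%MM <= 1)%N.
  by rewrite mdeg1 mdeg0.
pose idx j : lagrange_index m 1 :=
  exist _ (BMultinom (unit_lt j), BMultinom zero_lt) (idx_le j).
exists (fun ab => \sum_j (ab == idx j)%:R * lam j).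
  by move=> ab; apply: sumr_ge0 => j _; rewrite mulr_ge0.
move=> f g; congr (_ - _).
under eq_bigr do rewrite scaler_suml.
rewrite exchange_big; apply: eq_bigr => j _ /=.
rewrite (bigD1 (idx j))//= eqxx mul1r [X in _ + X]big1 ?addr0; last first.
  by move=> ab /negbTE ->; rewrite mul0r scale0r.
congr (_ *: _); rewrite (bigD1 j)//= [X in _ * X]big1 => [|i ij].
  by rewrite mnm1E eqxx mnm0E expr1 expr0 !mulr1.
by rewrite mnm1E eq_sym (negbTE ij) mnm0E !expr0 mulr1.
Qed.

Lemma lagrange_polynomial_le d (f : {mpoly R[n]}) (g : 'I_m -> {mpoly R[n]})
    (lambda : lagrange_index m d -> R) (x : 'rV[R]_n) :
  (forall ab, 0 <= lambda ab) -> (forall j, 0 <= (g j).@[x ord0] <= 1) ->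
  (lagrange_polynomial f g lambda).@[x ord0] <= f.@[x ord0].
Proof.
move=> lambda0 g01; rewrite mevalB gerBl (raddf_sum (meval _)).
apply: sumr_ge0 => ab _ /=; rewrite mevalZ mulr_ge0// rmorph_prod.
apply: prodr_ge0 => j _ /=; have /andP[g0 g1] := g01 j.
by rewrite mevalM !rmorphXn /= mevalB meval1 mulr_ge0// exprn_ge0// subr_ge0.
Qed.

Lemma sos_sonc_nonneg k (p : {mpoly R[n]}) :
  sos_sonc_cone k p -> nonneg_poly p.
Proof.
move=> [s [N [q [_ ->]]] [t [_ tsonc] <-]] x; rewrite mevalD addr_ge0//.
  rewrite (raddf_sum (meval _)) sumr_ge0// => i _ /=.
  by rewrite rmorphXn sqr_ge0.
exact: sonc_nonneg.
Qed.

Lemma sos_sonc_of_sonc k (p : {mpoly R[n]}) :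
  degree_le (2 * k) p -> sonc p -> sos_sonc_cone k p.
Proof.
move=> pk ps; exists 0; last by exists p => //; rewrite add0r.
by exists 0%N, (fun=> 0); split; [case|rewrite big_ord0].
Qed.

(** Stationarity cancels the linear terms of the gaps at [x], and complementary
    slackness cancels the constants [lam j * g j (x)]. *)
Lemma sonc_lagrangian k (f : {mpoly R[n]}) (g : 'I_m -> {mpoly R[n]})
    (lam : 'I_m -> R) (x : 'rV[R]_n) :
  first_order_sonc_convex k f ->
  (forall j, first_order_sonc_convex k (- g j)) ->
  (forall j, 0 <= lam j) ->
  gradient f x = \sum_j lam j *: gradient (g j) x ->
  (forall j, lam j * (g j).@[x ord0] = 0) ->
  sonc (f - \sum_j lam j *: g j - (f.@[x ord0])%:MP).
Proof.
move=> f_cvx g_cvx lam0 stationary slack.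
have -> : f - \sum_j lam j *: g j - (f.@[x ord0])%:MP =
    (f - (f.@[x ord0])%:MP - linear_form (gradient f x) x) +
    \sum_j lam j *: (- g j - ((- g j).@[x ord0])%:MP -
      linear_form (gradient (- g j) x) x).
  have -> : \sum_j lam j *: (- g j - ((- g j).@[x ord0])%:MP -
      linear_form (gradient (- g j) x) x) =
      linear_form (gradient f x) x - \sum_j lam j *: g j.
    rewrite stationary linear_form_sum -sumrB; apply: eq_bigr => j _.
    rewrite gradientN linear_formN linear_formZ mevalN mpolyCN !opprK.
    rewrite !scalerDr scalerN -[lam j *: _%:MP]mul_mpolyC -mpolyCM slack.
    by rewrite mpolyC0 addr0 addrC.
  by rewrite addrA subrK addrAC.
apply: soncD; first exact: sonc_gap_at f_cvx.
by apply: sonc_sum => j _; apply: soncZ => //; exact: sonc_gap_at.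
Qed.

End Lagrange.

Theorem theorem4p15 (R : realType) (n m k : nat)
    (f : {mpoly R[n]}) (g : 'I_m -> {mpoly R[n]})
    (K_nonempty : feasible_set g !=set0)
    (K_compact : compact (feasible_set g))
    (g_bounded : forall x, feasible_set g x ->
       forall j, 0 <= (g j).@[x ord0] <= 1)
    (g_generates : generates_algebra
       (range g `|` range (fun j => 1 - g j)))
    (slater : exists x0 : 'rV[R]_n, forall j, 0 < (g j).@[x0 ord0])
    (f_convex : first_order_sonc_convex k f)
    (g_concave : forall j, first_order_sonc_convex k (- g j)) :
  lagrange_bound 1 k f g =
  ereal_inf [set (f.@[x ord0])%:E | x in feasible_set g].
Proof.
have [x0 x0_slater] := slater.
have cf : {within feasible_set g, continuous (fun x : 'rV[R]_n => f.@[x ord0])}.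
  apply: continuous_subspaceT; apply: continuous_meval => i.
  exact: coord_continuous.
have [x /set_mem x_feas x_min] := EVT_min_rV K_nonempty K_compact cf.
have {}x_min y : feasible_set g y -> f.@[x ord0] <= f.@[y ord0].
  by move=> y_feas; apply: x_min; exact: mem_set.
apply/eqP; rewrite eq_le; apply/andP; split.
  apply: ge_ereal_sup => _ [t [lambda [lambda0 Lt]] <-].
  apply: le_ereal_inf_tmp => _ [y y_feas <-]; rewrite lee_fin.
  have := sos_sonc_nonneg Lt (y ord0); rewrite mevalB mevalC subr_ge0.
  move=> /le_trans; apply; apply: lagrange_polynomial_le => //.
  exact: g_bounded.
have [lam [lam0 stationary slack]] := kkt (convex_of_sonc_convex f_convex)
  (fun j => convex_of_sonc_convex (g_concave j)) x0_slater x_feas x_min.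
have [lambda lambda0 lambdaE] := lagrange_multipliers n lam0.
apply: (@le_trans _ _ (f.@[x ord0])%:E).
  by apply: ereal_inf_lbound; exists x.
apply: ereal_sup_ubound; exists f.@[x ord0] => //.
exists lambda; split=> //; rewrite lambdaE; apply: sos_sonc_of_sonc; last first.
  exact: (sonc_lagrangian f_convex g_concave lam0 stationary slack).
have [f_deg _] := f_convex.
have degree_le0 : degree_le (2 * k) (0 : {mpoly R[n]}).
  by rewrite /degree_le /= msize0.
have const_deg c : degree_le (2 * k) (c%:MP : {mpoly R[n]}).
  by rewrite /degree_le /= msizeC; case: (c != 0).
rewrite -[- _%:MP]scaleN1r; apply: degree_le_linear (const_deg _).
rewrite -sumrN; under eq_bigr do rewrite -scalerN.
have sum_deg : degree_le (2 * k) (\sum_j lam j *: - g j).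
  elim/big_ind: _ => // [p q pd qd|j _].
    by rewrite -[q]scale1r; exact: degree_le_linear.
  rewrite -[_ *: _]add0r; apply: degree_le_linear => //.
  by have [] := g_concave j.
by rewrite -[X in _ + X]scale1r; exact: degree_le_linear.
Qed.
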